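(* Let $k$ be an algebraically closed field of characteristic $0$ and let $n\geq 2$. Then the action of $GL_n(k)$ on $V(n):=(k^{n\times n})^2$ by simultaneous conjugation, $g\cdot(A,B)=(gAg^{-1},gBg^{-1})$, does not admit normal forms.
   Context: $k^{n\times n}$ is the space of $n\times n$-matrices over $k$, and $V(n)$ is regarded as an affine space (variety) over $k$ with the Zariski topology. Let $X$ be a (quasi-projective) variety over $k$ endowed with a morphic action $G\times X\to X$ of an algebraic group $G$. The action is said to admit normal forms if there is a constructible subset $N\subseteq X$ (a finite union of locally closed subsets in the Zariski topology) that hits each $G$-orbit in exactly one point. *)

(* Defs.v *)
From mathcomp Require Import all_boot all_order all_algebra.
From mathcomp Require Import mpoly.
From mathcomp Require Import boolp classical_sets.

Set Implicit Arguments.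
Unset Strict Implicit.
Unset Printing Implicit Defensive.

Import GRing.Theory.

Local Open Scope ring_scope.
Local Open Scope classical_set_scope.

Section PairsOfMatrices.
Variables (k : closedFieldType) (n : nat).

Definition matrix_pair : Type := ('M[k]_n * 'M[k]_n)%type.

(* The 2n^2 coordinate functions on the affine space of pairs: the entries of
   A in row-major order, followed by those of B. *)
Definition coords (x : matrix_pair) : 'I_(n * n + n * n) -> k :=
  row_mx (mxvec x.1) (mxvec x.2) 0.

Definition zariski_closed (Z : set matrix_pair) : Prop :=
  exists S : set {mpoly k[n * n + n * n]},
    Z = [set x | forall p, S p -> p.@[coords x] = 0].

Definition zariski_open (U : set matrix_pair) : Prop := zariski_closed (~` U).

Definition locally_closed (L : set matrix_pair) : Prop :=
  exists U Z : set matrix_pair,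
    [/\ zariski_open U, zariski_closed Z & L = U `&` Z].

Definition constructible (N : set matrix_pair) : Prop :=
  exists (r : nat) (L : 'I_r -> set matrix_pair),
    (forall i, locally_closed (L i)) /\ N = \bigcup_i L i.

Definition orbit (G : Type) (act : G -> matrix_pair -> matrix_pair)
    (x : matrix_pair) : set matrix_pair :=
  [set act g x | g in [set: G]].

Definition admits_normal_forms (G : Type)
    (act : G -> matrix_pair -> matrix_pair) : Prop :=
  exists N : set matrix_pair,
    constructible N /\ forall x, exists! y, (N `&` orbit act x) y.

(* The library's {'GL_n[R]} requires a finite ring R. *)
Definition GL : Type := {g : 'M[k]_n | g \in unitmx}.

Definition simultaneous_conjugation (g : GL) (x : matrix_pair) : matrix_pair :=
  (val g *m x.1 *m invmx (val g), val g *m x.2 *m invmx (val g)).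

End PairsOfMatrices.

Arguments simultaneous_conjugation {k n} g x.

(* Main.v *)
Require Import Defs.
From mathcomp Require Import all_boot all_order all_algebra.
From mathcomp Require Import perm closed_field mpoly boolp classical_sets.

(* Consider the pairs x(s,t) with A = s (E00 - E11) and B = t (E01 + E10), for
   s, t <> 0. The orbits of x(s,t), x(-s,t) and x(s,-t) coincide: swapping the
   two basis vectors negates s, and negating the second one negates t. If N is a
   set of normal forms, pick g with g x(s,t) g^-1 in N; since the commutant of
   x(s,t) acts by scalars on the plane spanned by the first two basis vectors,
   the slope m = g_i1 / g_i0 of a suitable row i depends on (s,t) only, and
   m(-s,t) = 1 / m(s,t), m(s,-t) = - m(s,t).
   When N is constructible, the graph of m is definable in the language of
   rings: Hilbert's basis theorem makes the equations finite in number, and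
   quantifier elimination removes g. A function with definable graph agrees
   generically with a rational function in characteristic 0, as all conjugates
   of its generic value belong to the same fibre of the graph. But no rational
   function satisfies both relations: it would have order 0 and be odd in t. *)

Set Implicit Arguments.
Unset Strict Implicit.
Unset Printing Implicit Defensive.

Import GRing.Theory.
Local Open Scope ring_scope.

(** * Hilbert's basis theorem *)

(** Dependent choice: a choice function is iterated by appending its value to the history. It serves
    to build infinite sequences out of failures of finiteness. *)
Lemma sequence_of_histories (T : Type) (P : seq T -> T -> Prop) :
  (forall h, exists x, P h x) -> exists u : nat -> T, forall n, P (mkseq u n) (u n).
Proof.
move=> /choice[f fP]; pose fix h n := if n is m.+1 then rcons (h m) (f (h m)) else [::].
exists (fun n => f (h n)) => n; have -> : mkseq (fun n => f (h n)) n = h n.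
  elim: n => // n; rewrite /mkseq -addn1 iotaD map_cat /= addn1 => -> /=.
  by rewrite add0n cats1.
exact: fP.
Qed.

Definition combination (R : comNzRingType) (u : nat -> R) (N : nat) (p : R) : Prop :=
  exists c : nat -> R, p = \sum_(i < N) c i * u i.

(** The ascending chain condition, stated on generators: the ideals of the initial segments of [u]
    cannot grow at every step. *)
Definition noetherian (R : comNzRingType) : Prop :=
  forall u : nat -> R, exists N, combination u N (u N).

Lemma noetherian_field (F : fieldType) : noetherian F.
Proof.
move=> u; have [u0|u0] := eqVneq (u 0) 0.
  by exists 0, (fun=> 0); rewrite big_ord0.
exists 1, (fun=> u 1 / u 0).
by rewrite big_ord1 mulfVK.
Qed.

Lemma noetherian_surj (R S : comNzRingType) (f : {rmorphism R -> S}) :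
  (forall y, exists x, f x = y) -> noetherian R -> noetherian S.
Proof.
move=> /choice[g gK] noethR u; have [N [c Nc]] := noethR (g \o u).
exists N, (f \o c); rewrite -[LHS]gK [g _]Nc rmorph_sum.
by apply: eq_bigr => i _; rewrite rmorphM /= gK.
Qed.

Section Hilbert.
Variables (R : comNzRingType) (u : nat -> {poly R}).

Let I (p : {poly R}) : Prop := exists N, combination u N p.

Lemma combinationW M N p : (M <= N)%N -> combination u M p -> combination u N p.
Proof.
move=> leMN [c ->]; exists (fun i => if (i < M)%N then c i else 0).
rewrite (big_ord_widen N (fun i => c i * u i) leMN) big_mkcond.
by apply: eq_bigr => i _; case: ifP => //; rewrite mul0r.
Qed.

Lemma combinationD N p q : combination u N p -> combination u N q -> combination u N (p + q).
Proof.
move=> [c ->] [d ->]; exists (fun i => c i + d i).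
by rewrite -big_split; apply: eq_bigr => i _; rewrite mulrDl.
Qed.

Lemma combinationM N p q : combination u N p -> combination u N (q * p).
Proof.
move=> [c ->]; exists (fun i => q * c i).
by rewrite mulr_sumr; apply: eq_bigr => i _; rewrite mulrA.
Qed.

Let ID p q : I p -> I q -> I (p + q).
Proof.
move=> [M pM] [N qN]; exists (M + N)%N.
by apply: combinationD; [apply: combinationW pM; rewrite leq_addr
                        |apply: combinationW qN; rewrite leq_addl].
Qed.

Let IM p q : I p -> I (q * p).
Proof. by move=> [N pN]; exists N; apply: combinationM. Qed.

(** Otherwise choose [v n] of least degree in [I] outside the ideal of its predecessors. Some
    leading coefficient is a combination of the earlier ones; cancelling it yields an element of
    smaller degree that is still missed. *)
Lemma noetherian_poly_seq : noetherian R -> exists N, combination u N (u N).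
Proof.
move=> noethR; apply: contrapT => noN.
pose gen (h : seq {poly R}) (p : {poly R}) :=
  exists c : nat -> {poly R}, p = \sum_(i < size h) c i * h`_i.
have Iu i : I (u i).
  exists i.+1, (fun j => (j == i)%:R).
  rewrite big_ord_recr /= eqxx mul1r big1 ?add0r // => j _.
  by rewrite ltn_eqF ?mul0r.
(* The next element has least degree among those of the ideal that the history misses. *)
have step (h : seq {poly R}) : exists p, (forall q, q \in h -> I q) ->
    [/\ I p, ~ gen h p & forall q, I q -> ~ gen h q -> (size p <= size q)%N].
  have [hI|nhI] := pselect (forall q, q \in h -> I q); last by exists 0 => /nhI.
  (* Finitely many elements of [I] are combinations of one initial segment of [u]. *)
  have [N hN] : exists N, forall q, q \in h -> combination u N q.
    elim: h hI => [|q h IHh] hI; first by exists 0.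
    have [|N hN] := IHh; first by move=> r rh; apply: hI; rewrite inE rh orbT.
    have [M qM] := hI q (mem_head _ _); exists (M + N)%N => r.
    rewrite inE => /predU1P[->|/hN]; apply: combinationW.
    - exact: leq_addr.
    - by [].
    - exact: leq_addl.
  have ngen : ~ gen h (u N).
    move=> [c uN]; apply: noN; exists N; rewrite uN.
    elim/big_ind: _ => [|p q|i _].
    - by exists (fun=> 0); rewrite big1 // => i _; rewrite mul0r.
    - exact: combinationD.
    - by apply/combinationM/hN/mem_nth.
  pose P m := `[< exists q, [/\ I q, ~ gen h q & size q = m] >].
  have exP : exists m, P m by exists (size (u N)); apply/asboolP; exists (u N).
  case: (ex_minnP exP) => m /asboolP[p [Ip ngp <-]] minp.
  exists p => _; split=> // q Iq ngq; apply: minp; apply/asboolP; by exists q.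
have [v vP] := sequence_of_histories step.
have vI n : I (v n).
  elim/ltn_ind: n => n IHn.
  by have [] // := vP n; move=> q /mapP[i]; rewrite mem_iota => /IHn ? ->.
have {vP}vP n : ~ gen (mkseq v n) (v n)
    /\ forall q, I q -> ~ gen (mkseq v n) q -> (size (v n) <= size q)%N.
  by have [] // := vP n; move=> q /mapP[i _ ->].
have [N [c lcN]] := noethR (fun i => lead_coef (v i)).
have [ngN minN] := vP N.
(* A relation expressing [v N] through the first [i] terms could be padded by zeros up to [N]; so
   [v N] was already a candidate when [v i] was chosen. *)
have le_size i : (i < N)%N -> (size (v i) <= size (v N))%N.
  move=> ltiN; have [_ mini] := vP i; apply: mini => // -[d vN].
  apply: ngN; exists (fun j => if (j < i)%N then d j else 0); rewrite vN !size_mkseq.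
  rewrite [RHS](eq_bigr (fun j : 'I_N => if (j < i)%N then d j * v j else 0)); last first.
    by move=> j _; rewrite nth_mkseq //; case: ifP; rewrite ?mul0r.
  rewrite -big_mkcond -(big_ord_widen N (fun j => d j * v j) (ltnW ltiN)).
  by apply: eq_bigr => j _; rewrite nth_mkseq.
(* Shifting each [v i] to the degree of [v N] gives [w] the same top coefficient as [v N]. *)
pose w := \sum_(i < N) (c i *: 'X^(size (v N) - size (v i))) * v i.
have vN_neq0 : v N != 0.
  apply/eqP => vN0; apply: ngN; exists (fun=> 0).
  by rewrite vN0 big1 // => i _; rewrite mul0r.
have gw : gen (mkseq v N) w.
  exists (fun i => c i *: 'X^(size (v N) - size (v i))); rewrite size_mkseq.
  by apply: eq_bigr => i _; rewrite nth_mkseq.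
have : (size (v N) <= size (v N - w)%R)%N.
  apply: minN.
    apply: ID => //; rewrite -sumrN; elim/big_ind: _ => [| |i _].
    - by exists 0, (fun=> 0); rewrite big_ord0.
    - exact: ID.
    - by rewrite -mulNr; apply: IM.
  move=> [d vNw]; have [e wE] := gw; apply: ngN; exists (fun i => d i + e i).
  rewrite -[LHS](subrK w) vNw wE -big_split.
  by apply: eq_bigr => i _; rewrite mulrDl.
apply/negP; rewrite -ltnNge.
have size_w : (size w <= size (v N))%N.
  apply: (leq_trans (size_sum _ _ _)); apply/bigmax_leqP => i _.
  rewrite -scalerAl mulrC; apply: (leq_trans (size_scale_leq _ _)).
  apply: (leq_trans (size_polyMleq _ _)); rewrite size_polyXn addnS /=.
  by rewrite subnKC // le_size.
have [n sN] : exists n, size (v N) = n.+1.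
  by exists (size (v N)).-1; rewrite prednK // size_poly_gt0.
rewrite sN ltnS; apply/leq_sizeP => j; rewrite leq_eqVlt => /predU1P[<-|ltnj].
  rewrite coefB /w coef_sum (_ : (v N)`_n = lead_coef (v N)); last by rewrite lead_coefE sN.
  rewrite lcN -sumrB big1 // => i _.
  have vi_gt0 : (0 < size (v i))%N.
    rewrite size_poly_gt0; apply/eqP => vi0; case: (vP i) => + _; apply.
    by exists (fun=> 0); rewrite vi0 big1 // => l _; rewrite mul0r.
  have := le_size i (ltn_ord i).
  rewrite -scalerAl coefZ coefXnM lead_coefE sN => le_vi.
  rewrite ltnNge leq_subLR -addn1 addnC leq_add //=.
  suff -> : (n - (n.+1 - size (v i)) = (size (v i)).-1)%N by rewrite subrr.
  by case: (size (v i)) vi_gt0 le_vi => // l _; rewrite ltnS subSS => /subKn.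
by rewrite coefB !nth_default ?subr0 // ?sN // (leq_trans size_w) // sN.
Qed.

End Hilbert.

Lemma noetherian_poly (R : comNzRingType) : noetherian R -> noetherian {poly R}.
Proof. by move=> noethR u; apply: noetherian_poly_seq. Qed.

(** By induction, as [{poly {mpoly F[n]}}] maps onto [{mpoly F[n.+1]}] with ['X] going to the last
    variable; surjectivity is checked on constants and variables. *)
Lemma noetherian_mpoly (F : fieldType) (n : nat) : noetherian {mpoly F[n]}.
Proof.
elim: n => [|n IHn].
  pose f : {rmorphism F -> {mpoly F[0]}} := @mpolyC 0 F.
  apply: (noetherian_surj (f := f)) (@noetherian_field F) => p.
  exists p@_0; apply/mpolyP => m; rewrite mcoeffC.
  have -> : m = 0%MM by apply/mnmP => -[].
  by rewrite eqxx mulr1.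
have eval_comm : commr_rmorph (@mwiden n F) 'X_ord_max by move=> p; apply: mulrC.
pose f : {rmorphism {poly {mpoly F[n]}} -> {mpoly F[n.+1]}} := horner_morph eval_comm.
apply: (noetherian_surj (f := f)) (noetherian_poly IHn) => p.
rewrite (mpolyE p); elim/big_ind: _ => [|x y [a <-] [b <-]|m _].
- by exists 0; rewrite rmorph0.
- by exists (a + b); rewrite rmorphD.
rewrite mpolyXE_id -mul_mpolyC.
suff [b <-] : exists b, f b = \prod_(i < n.+1) 'X_i ^+ m i.
  exists ((p@_m)%:MP%:P * b); rewrite rmorphM /=; congr (_ * _).
  by rewrite /f /horner_morph map_polyC hornerC /= mwidenC.
elim/big_ind: _ => [|x y [a <-] [b <-]|i _].
- by exists 1; rewrite rmorph1.
- by exists (a * b); rewrite rmorphM.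
case: (unliftP ord_max i) => [j|] ->.
  exists (('X_j)%:P ^+ m (lift ord_max j)); rewrite rmorphXn /=; congr (_ ^+ _).
  rewrite /f /horner_morph map_polyC hornerC /= mwidenX mnmwiden1.
  by congr 'X_[U_(_)]; apply: val_inj; rewrite /= /bump leqNgt ltn_ord.
exists ('X ^+ m ord_max); rewrite rmorphXn /=; congr (_ ^+ _).
by rewrite /f /horner_morph map_polyX hornerX.
Qed.

(** If no finite [T] worked, each finite part of [S] would have a common zero at which some other
    element of [S] does not vanish. In the resulting sequence no term is a combination of the
    earlier ones. *)
Lemma finite_zero_locus (F : fieldType) (n : nat) (S : set {mpoly F[n]}) :
  exists T : seq {mpoly F[n]}, forall v : 'I_n -> F,
    (forall p, S p -> p.@[v] = 0) <-> (forall p, p \in T -> p.@[v] = 0).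
Proof.
apply: contrapT => noT.
have step (h : seq {mpoly F[n]}) : exists p, (forall q, q \in h -> S q) ->
    S p /\ exists2 v, (forall q, q \in h -> q.@[v] = 0) & p.@[v] != 0.
  have [hS|nhS] := pselect (forall q, q \in h -> S q); last by exists 0 => /nhS.
  apply: contrapT => nop; apply: noT; exists h => v; split=> [Sv p /hS/Sv //|hv p Sp].
  apply: contrapT => /eqP pv; apply: nop; exists p => _; split=> //; by exists v.
have [u uP] := sequence_of_histories step.
have Su i : S (u i).
  elim/ltn_ind: i => i IHi.
  by have [] // := uP i; move=> q /mapP[j]; rewrite mem_iota => /IHi ? ->.
have [N [c uN]] := noetherian_mpoly u.
have [|_ [v hv /eqP[]]] := uP N; first by move=> q /mapP[i _ ->].
rewrite uN rmorph_sum big1 // => i _.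
rewrite rmorphM /= (hv (u i)) ?mulr0 //; apply/mapP.
by exists (val i); rewrite ?mem_iota /=.
Qed.

(** * Functions with definable graph are generically rational *)

(** The gcd is equivalent to [p], constant, or of intermediate degree. Over a domain, division and
    Bezout hold up to a nonzero factor [c]; with coefficients in $k[s][t]$ this factor is
    generically nonzero. *)
Lemma dvdp_coprimep_or_split (R : idomainType) (p q : {poly R}) : p != 0 ->
  [\/ exists2 c, c != 0 & exists h, c *: q = h * p,
      exists2 c, c != 0 & exists u v, c%:P = u * p + v * q |
      exists2 c, c != 0 & exists g h,
        [/\ c *: p = g * h, (size g < size p)%N & (size h < size p)%N]].
Proof.
move=> p0; have [sg|sg] := eqVneq (size (gcdp p q)) 1%N.
  constructor 2; have [[u v] /= /eqp_size] := Bezoutp p q; rewrite sg.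
  by move/eqP/size_poly1P => [c c0 uvc]; exists c => //; exists u, v.
have g0 : gcdp p q != 0 by rewrite gcdp_eq0 (negPf p0).
have le_gp : (size (gcdp p q) <= size p)%N by rewrite dvdp_leq ?dvdp_gcdl.
have /Pdiv.Idomain.dvdpP[[c h] /= c0 gh] := dvdp_gcdl p q.
have [sgp|sgp] := eqVneq (size (gcdp p q)) (size p).
  constructor 1.
  have : p %| q.
    apply: dvdp_trans (dvdp_gcdr p q).
    by have := dvdp_size_eqp (dvdp_gcdl p q); rewrite sgp eqxx => /esym/eqp_dvdl <-.
  by move=> /Pdiv.Idomain.dvdpP[[e r] e0 eE]; exists e => //; exists r.
constructor 3; exists c => //; exists (gcdp p q), h.
rewrite mulrC gh ltn_neqAle sgp le_gp; split=> //.
have h0 : h != 0.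
  by apply: contra_eqN gh => /eqP ->; rewrite mul0r scale_poly_eq0 negb_or c0.
have := congr1 (fun r : {poly R} => size r) gh.
rewrite size_scale // size_mul // => ->.
have : (1 < size (gcdp p q))%N by rewrite ltn_neqAle eq_sym sg size_poly_gt0.
by case: (size (gcdp p q)) => // -[] // l _; rewrite !addnS /= ltnS leq_addr.
Qed.

Section GenericRationality.
Variable k : closedFieldType.
Hypothesis char0 : [pchar k] =i pred0.

(* The inner variable is evaluated at [s], the outer one at [t]. *)
Definition eval2 (s t : k) : {rmorphism {poly {poly k}} -> k} :=
  horner_eval t \o map_poly (horner_eval s).

Definition eval3 (s t m : k) : {rmorphism {poly {poly {poly k}}} -> k} :=
  horner_eval m \o map_poly (eval2 s t).

Lemma eval2E s t p : eval2 s t p = (map_poly (horner_eval s) p).[t].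
Proof. by []. Qed.

Lemma eval3E s t m F : eval3 s t m F = (map_poly (eval2 s t) F).[m].
Proof. by []. Qed.

Lemma eval3C s t m p : eval3 s t m p%:P = eval2 s t p.
Proof. by rewrite eval3E map_polyC hornerC. Qed.

Lemma eval3X s t m : eval3 s t m 'X = m.
Proof. by rewrite eval3E map_polyX hornerX. Qed.

Lemma eval3Z s t m p F : eval3 s t m (p *: F) = eval2 s t p * eval3 s t m F.
Proof. by rewrite -mul_polyC rmorphM eval3C. Qed.

Lemma eval2C s t p : eval2 s t p%:P = p.[s].
Proof. by rewrite eval2E map_polyC hornerC. Qed.

Lemma eval2X s t : eval2 s t 'X = t.
Proof. by rewrite eval2E map_polyX hornerX. Qed.

(** First [s] avoids the roots of the leading coefficient, so that [D] specializes to a nonzero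
    polynomial; then [t] avoids the roots of the latter. *)
Lemma eval2_neq0 D : D != 0 -> exists s t, eval2 s t D != 0.
Proof.
rewrite -lead_coef_eq0 => /closed_nonrootP[s Ds].
have /closed_nonrootP[t Dt] : map_poly (horner_eval s) D != 0.
  by rewrite -size_poly_gt0 size_map_poly_id0 // size_poly_gt0 -lead_coef_eq0;
     apply: contraNneq Ds => ->; rewrite root0.
by exists s, t.
Qed.

Lemma eval2_eq0 D : (forall s t, eval2 s t D = 0) -> D = 0.
Proof. by move=> D0; apply/eqP; apply: contrapT => /negP /eval2_neq0[s [t /eqP[]]]. Qed.

(** Zariski density in the plane, tested on principal open sets. *)
Definition dense (A : k -> k -> Prop) : Prop :=
  forall D, D != 0 -> exists s t, A s t /\ eval2 s t D != 0.

Lemma dense_sub (A B : k -> k -> Prop) :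
  (forall s t, A s t -> B s t) -> dense A -> dense B.
Proof. by move=> AB dA D /dA[s [t [/AB ? ?]]]; exists s, t. Qed.

(** Irreducibility of the plane: if [D] and [E] refute the density of [A] and [B], then [D * E]
    refutes that of the union. *)
Lemma denseU (A B : k -> k -> Prop) :
  dense (fun s t => A s t \/ B s t) -> dense A \/ dense B.
Proof.
move=> dAB; apply: contrapT => /not_orP[/existsNP[D nD] /existsNP[E nE]].
move/not_implyP: nD => [D0 nD]; move/not_implyP: nE => [E0 nE].
have [|s [t [AB]]] := dAB (D * E); first by rewrite mulf_neq0.
rewrite rmorphM mulf_eq0 negb_or => /andP[? ?].
by case: AB => ?; [apply: nD | apply: nE]; exists s, t.
Qed.

Lemma dense_exists (I : finType) (A : I -> k -> k -> Prop) :
  dense (fun s t => exists i, A i s t) -> exists i, dense (A i).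
Proof.
move=> dA; suff H (r : seq I) : dense (fun s t => exists2 i, i \in r & A i s t) ->
    exists i, dense (A i).
  apply: (H (enum I)); apply: dense_sub dA => s t [i Ai].
  by exists i; rewrite ?mem_enum.
elim: r => [/(_ 1 (oner_neq0 _))[s [t [[]]]] //|i r IHr] dr.
have [||] := @denseU (A i) (fun s t => exists2 i, i \in r & A i s t).
- apply: dense_sub dr => s t [j]; rewrite inE => /predU1P[->|jr Aj]; first by left.
  by right; exists j.
- by exists i.
- exact: IHr.
Qed.

(** The sets invariant under this relation are the Boolean combinations of the equations [f = 0], so
    invariance stands for quantifier-free definability. *)
Definition agree_on (fs : seq {poly {poly {poly k}}}) (s t m s' t' m' : k) : Prop :=
  forall f, f \in fs -> (eval3 s t m f == 0) = (eval3 s' t' m' f == 0).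

Variables (fs : seq {poly {poly {poly k}}}) (Psi : k -> k -> k -> Prop).
Hypothesis Psi_agree : forall s t m s' t' m',
  agree_on fs s t m s' t' m' -> Psi s t m -> Psi s' t' m'.
Hypothesis Psi_uniq : forall s t m m', Psi s t m -> Psi s t m' -> m = m'.
Hypothesis Psi_dense : dense (fun s t => exists m, Psi s t m).

Let locus F s t := exists2 m, Psi s t m & eval3 s t m F = 0.

Lemma eval3_neq0 F s t : eval2 s t (lead_coef F) != 0 -> map_poly (eval2 s t) F != 0.
Proof.
move=> lF; rewrite -size_poly_gt0 size_map_poly_id0 // size_poly_gt0.
by rewrite -lead_coef_eq0; apply: contraNneq lF => ->; rewrite rmorph0.
Qed.

(** All points off the zeros of the product of the nonzero members of [fs] agree on [fs]. A graph
    point among them, over a generic (s,t), would share its fibre with a second one. *)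
Lemma dense_locus_exists : exists2 F, F != 0 & dense (locus F).
Proof.
pose F := \prod_(f <- fs | f != 0) f.
have F0 : F != 0 by rewrite prodf_seq_neq0; apply/allP => f _; apply/implyP.
exists F => //.
have [|//|dN] := @denseU (locus F) (fun s t => exists2 m, Psi s t m & eval3 s t m F != 0).
  apply: dense_sub Psi_dense => s t [m Pm].
  by have [|] := eqVneq (eval3 s t m F) 0; [left|right]; exists m.
have [|s [t [[m Pm Fm] lF]]] := dN (lead_coef F); first by rewrite lead_coef_eq0.
have /closed_nonrootP[m'] : map_poly (eval2 s t) F * ('X - m%:P) != 0.
  by rewrite mulf_neq0 ?polyXsubC_eq0 ?eval3_neq0.
rewrite rootM root_XsubC negb_or => /andP[Fm' /eqP[]].
apply: (Psi_uniq _ Pm); apply: Psi_agree Pm => f ffs.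
have [->|f0] := eqVneq f 0; first by rewrite !rmorph0 !eqxx.
have divF n : eval3 s t n F != 0 -> (eval3 s t n f == 0) = false.
  apply: contraNF => /eqP fn; rewrite rmorph_prod prodf_seq_eq0.
  by apply/hasP; exists f => //; rewrite f0 fn eqxx.
by rewrite !divF.
Qed.

(* Choose F of least degree among the nonzero polynomials vanishing on a dense part
   of the graph. By minimality each polynomial of [fs] is generically zero at all
   roots of F or at none, so all of them lie on the graph; hence F, which is
   separable, has degree 1. *)
Lemma generic_rationality : exists P Q D, D != 0 /\
  forall s t, eval2 s t D != 0 ->
    eval2 s t Q != 0 /\ Psi s t (eval2 s t P / eval2 s t Q).
Proof.
pose good n := `[< exists F, [/\ F != 0, dense (locus F) & size F = n] >].
have exg : exists n, good n.
  by have [F F0 dF] := dense_locus_exists; exists (size F); apply/asboolP; exists F.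
case: (ex_minnP exg) => n /asboolP[F [F0 dF <-]] minF {exg n}.
(* A proper factorization of [F] would make the locus of one factor dense, against minimality. *)
have no_split c G H : c != 0 -> c *: F = G * H ->
    (size G < size F)%N -> (size H < size F)%N -> False.
  move=> c0 cF ltG ltH.
  have /andP[G0 H0] : (G != 0) && (H != 0).
    by rewrite -negb_or -mulf_eq0 -cF scale_poly_eq0 negb_or c0.
  have [|dG|dH] := @denseU (locus G) (locus H).
  - apply: dense_sub dF => s t [m Pm Fm].
    have : eval3 s t m (G * H) = 0 by rewrite -cF eval3Z Fm mulr0.
    by rewrite rmorphM => /eqP; rewrite mulf_eq0 => /orP[] /eqP ?; [left|right]; exists m.
  - have goodG : good (size G) by apply/asboolP; exists G.
    by have := leq_trans ltG (minF _ goodG); rewrite ltnn.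
  - have goodH : good (size H) by apply/asboolP; exists H.
    by have := leq_trans ltH (minF _ goodH); rewrite ltnn.
have agreeF (f : {poly {poly {poly k}}}) : exists2 c, c != 0 &
    (forall s t m, eval2 s t c != 0 -> eval3 s t m F = 0 -> eval3 s t m f = 0) \/
    (forall s t m, eval2 s t c != 0 -> eval3 s t m F = 0 -> eval3 s t m f != 0).
  have [[c c0 [h hE]]|[c c0 [u [v uvE]]]|[c c0 [G [H [GH ltG ltH]]]]] :=
      dvdp_coprimep_or_split f F0.
  - exists c => //; left=> s t m cst Fm; apply/eqP.
    have : eval2 s t c * eval3 s t m f == 0 by rewrite -eval3Z hE rmorphM Fm mulr0.
    by rewrite mulf_eq0 (negPf cst).
  - exists c => //; right=> s t m + Fm; apply: contraNneq => fm.
    by rewrite -(eval3C s t m) uvE rmorphD !rmorphM Fm fm !mulr0 addr0.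
  - by have := no_split _ _ _ c0 GH ltG ltH.
(* [C] collects the exceptional factors; off its zeros, the same alternative holds for all
   parameters and all roots of [F]. *)
have [C C0 CP] : exists2 C, C != 0 & forall f, f \in fs ->
    (forall s t m, eval2 s t C != 0 -> eval3 s t m F = 0 -> eval3 s t m f = 0) \/
    (forall s t m, eval2 s t C != 0 -> eval3 s t m F = 0 -> eval3 s t m f != 0).
  elim: (fs) => [|f r [C C0 CP]]; first by exists 1; rewrite ?oner_neq0.
  have [c c0 cP] := agreeF f; exists (c * C); first by rewrite mulf_neq0.
  have split_cC s t : eval2 s t (c * C) != 0 -> eval2 s t c != 0 /\ eval2 s t C != 0.
    by rewrite rmorphM mulf_eq0 negb_or => /andP.
  move=> g; rewrite inE => /predU1P[->|/CP gP]; [case: cP => cP|case: gP => gP].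
  - by left=> s t m /split_cC[+ _]; apply: cP.
  - by right=> s t m /split_cC[+ _]; apply: cP.
  - by left=> s t m /split_cC[_]; apply: gP.
  - by right=> s t m /split_cC[_]; apply: gP.
have size_F : (1 < size F)%N.
  rewrite ltnNge; apply/negP => /size1_polyC FC.
  have c0 : F`_0 != 0 by move: F0; rewrite {1}FC polyC_eq0.
  have [s [t [[m _]]]] := dF _ c0.
  by rewrite FC eval3C coefC eqxx => ->; rewrite eqxx.
(* Separability: in characteristic 0 the derivative of [F] is nonzero of smaller degree, hence no
   multiple of [F], and Bezout makes the roots simple off the zeros of [E]. *)
have [E E0 EP] : exists2 E, E != 0 &
    forall s t m, eval2 s t E != 0 -> eval3 s t m F = 0 -> eval3 s t m F^`() != 0.
  have dF0 : F^`() != 0.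
    have [n sF] : exists n, size F = n.+2 by exists (size F).-2; case: (size F) size_F => [|[]].
    have lF : F`_n.+1 != 0 by have := F0; rewrite -lead_coef_eq0 lead_coefE sF.
    apply: contraNneq lF => /(congr1 (fun p : {poly _} => p`_n)).
    rewrite coef_deriv coef0 -mulr_natr => /eqP; rewrite mulf_eq0 => /orP[] //.
    have /pcharf0P nat0 : [pchar {poly {poly k}}] =i pred0.
      move=> p; rewrite -(char0 p) inE /= inE; congr (_ && _).
      by rewrite -!polyC_natr !polyC_eq0.
    by rewrite nat0.
  have lt_dF : (size F^`() < size F)%N by apply: lt_size_deriv.
  have [[c c0 [h hE]]|[c c0 [u [v uvE]]]|[c c0 [G [H [GH ltG ltH]]]]] :=
      dvdp_coprimep_or_split F^`() F0.
  - have h0 : h != 0.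
      by apply: contra_eqN hE => /eqP ->; rewrite mul0r scale_poly_eq0 negb_or c0.
    have := congr1 (fun r : {poly _} => size r) hE; rewrite size_scale // size_mul // => sE.
    have : (size F <= size F^`())%N.
      by rewrite sE -(prednK (_ : 0 < size h)%N) ?size_poly_gt0 // addSn leq_addl.
    by rewrite leqNgt lt_dF.
  - exists c => // s t m + Fm; apply: contraNneq => fm.
    by rewrite -(eval3C s t m) uvE rmorphD !rmorphM Fm fm !mulr0 addr0.
  - by have := no_split _ _ _ c0 GH ltG ltH.
pose D := lead_coef F * (E * C).
have D0 : D != 0 by rewrite !mulf_neq0 ?lead_coef_eq0.
have split_D s t : eval2 s t D != 0 ->
    [/\ eval2 s t (lead_coef F) != 0, eval2 s t E != 0 & eval2 s t C != 0].
  by rewrite !rmorphM !mulf_eq0 !negb_or => /and3P.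
(* Agreement also relates different parameters, so a single graph point puts all roots of [F] over
   [D != 0] on the graph. *)
have agreeD s t m s' t' m' : eval2 s t D != 0 -> eval2 s' t' D != 0 ->
    eval3 s t m F = 0 -> eval3 s' t' m' F = 0 -> agree_on fs s t m s' t' m'.
  move=> /split_D[_ _ Cst] /split_D[_ _ Cst'] Fm Fm' f /CP[] fP.
    by rewrite !fP // !eqxx.
  by rewrite !(negPf (fP _ _ _ _ _)).
have [s0 [t0 [[m0 Psi0 F0m] D0st]]] := dF _ D0.
have {}size_F : size F = 2.
  have [lF0 EF0 _] := split_D _ _ D0st.
  have sizeF0 : size (map_poly (eval2 s0 t0) F) = size F by apply: size_map_poly_id0.
  have /factor_theorem[q qE] : root (map_poly (eval2 s0 t0) F) m0 by apply/rootP.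
  have q0 : q != 0 by apply: contraTneq (eval3_neq0 lF0) => q0; rewrite qE q0 mul0r eqxx.
  apply/eqP; rewrite -sizeF0 qE size_mul ?polyXsubC_eq0 // size_XsubC addn2 /= eqSS.
  (* A root [m1] of the cofactor would lie on the graph, hence equal [m0] by uniqueness, and [m0]
     would be a double root. *)
  apply/negPn/closed_rootP => -[m1 qm1].
  have m1E : m0 = m1.
    apply: (Psi_uniq Psi0); apply: Psi_agree Psi0; apply: agreeD => //.
    by rewrite eval3E qE hornerM (rootP qm1) mul0r.
  have /eqP[] := EP s0 t0 m0 EF0 F0m.
  rewrite eval3E -deriv_map qE derivM derivXsubC hornerD !hornerM hornerXsubC.
  by rewrite subrr mulr0 add0r hornerC mulr1 m1E (rootP qm1).
have FE : F = (lead_coef F) *: 'X + (F`_0)%:P.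
  apply/polyP => -[|[|i]]; rewrite coefD coefZ coefX coefC ?mulr0 ?add0r //=.
    by rewrite mulr1 addr0 lead_coefE size_F.
  by rewrite nth_default // size_F.
(* The root of the linear polynomial [F]. *)
exists (- F`_0), (lead_coef F), D; split=> // s t Dst.
have [lF _ _] := split_D _ _ Dst; split=> //.
apply: Psi_agree Psi0; apply: agreeD => //.
have -> m : eval3 s t m F = eval2 s t (lead_coef F) * m + eval2 s t F`_0.
  by rewrite {1}FE rmorphD eval3Z eval3C eval3X.
by rewrite rmorphN mulrCA mulfV // mulr1 addNr.
Qed.

End GenericRationality.

(** * Rational functions that are odd and inverted by a sign change *)

Lemma mulXn_order_inj (R : idomainType) (p q : {poly R}) (m n : nat) :
  p`_0 != 0 -> q`_0 != 0 -> p * 'X^m = q * 'X^n -> m = n.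
Proof.
wlog lemn : p q m n / (m <= n)%N => [hwlog p0 q0 E|p0 _ /(congr1 (fun r : {poly R} => r`_m))].
  have [lemn|/ltnW lenm] := leqP m n; first exact: hwlog lemn p0 q0 E.
  by apply/esym/(hwlog q p) => //; rewrite E.
rewrite !coefMXn ltnn subnn; case: ltnP => [_ /eqP|lenm _]; first by rewrite (negPf p0).
by apply/eqP; rewrite eqn_leq lemn.
Qed.

Section OddFunctions.
Variable k : closedFieldType.
Hypothesis char0 : [pchar k] =i pred0.

Definition neg_inner : {rmorphism {poly {poly k}} -> {poly {poly k}}} :=
  map_poly (comp_poly (- 'X)).

Definition neg_outer : {rmorphism {poly {poly k}} -> {poly {poly k}}} :=
  comp_poly (- 'X).

Lemma eval2_neg_inner s t p : eval2 s t (neg_inner p) = eval2 (- s) t p.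
Proof.
rewrite !eval2E /= -map_poly_comp; congr horner; apply: eq_map_poly => q /=.
by rewrite /horner_eval horner_comp hornerN hornerX.
Qed.

Lemma eval2_neg_outer s t p : eval2 s t (neg_outer p) = eval2 s (- t) p.
Proof. by rewrite !eval2E /= map_comp_poly horner_comp rmorphN /= map_polyX hornerN hornerX. Qed.

(* The second relation makes [P / Q] odd in the outer variable; by the first one
   it has order 0 there, so that it would take the value [0 = - 0] at 0. *)
Lemma no_odd_inverse (P Q : {poly {poly k}}) : Q != 0 ->
  P * neg_inner P = Q * neg_inner Q -> neg_outer P * Q <> - (P * neg_outer Q).
Proof.
move=> Q0 innerPQ outerPQ.
have neg_inner_coef (p : {poly {poly k}}) i : (neg_inner p)`_i = p`_i \Po (- 'X).
  by rewrite coef_map.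
have neg_inner_neq0 (p : {poly k}) : p != 0 -> p \Po (- 'X) != 0.
  apply: contraNneq => /(congr1 (comp_poly (- 'X))).
  by rewrite -comp_polyA rmorphN /= comp_polyX opprK comp_polyXr comp_poly0 => ->.
have neg_outer0 p : (neg_outer p)`_0 = p`_0.
  by rewrite -!horner_coef0 horner_comp hornerN hornerX oppr0.
have P0 : P != 0.
  apply: contraNneq (Q0) => P0; move/eqP: innerPQ; rewrite P0 mul0r eq_sym mulf_eq0.
  case/orP => // /eqP /polyP Q'0; apply/eqP/polyP => i; apply/eqP; rewrite coef0.
  by apply/negPn/negP => /neg_inner_neq0; rewrite -neg_inner_coef Q'0 coef0 eqxx.
(* [i] and [j] are the orders of [P] and [Q] in the outer variable; [neg_inner] preserves them, and
   the first relation gives $2i = 2j$. *)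
have [i [P1 + PE]] := multiplicity_XsubC P 0.
have [j [Q1 + QE]] := multiplicity_XsubC Q 0.
rewrite P0 Q0 /= /root !horner_coef0 => Q10 P10; rewrite polyC0 subr0 in PE QE.
have order_eq : (i + i = j + j)%N.
  apply: (@mulXn_order_inj _ (P1 * neg_inner P1) (Q1 * neg_inner Q1)).
  - by rewrite coef0M neg_inner_coef mulf_neq0 ?neg_inner_neq0.
  - by rewrite coef0M neg_inner_coef mulf_neq0 ?neg_inner_neq0.
  move: innerPQ; rewrite PE QE !rmorphM !rmorphXn /= !map_polyX.
  by rewrite mulrACA -exprD => ->; rewrite mulrACA -exprD.
have {order_eq}ij : i = j by move: order_eq; rewrite !addnn => /double_inj.
(* Once the powers of the outer variable are cancelled, comparison at 0 gives $2 P_1(0) Q_1(0) =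
   0$. *)
have : neg_outer P1 * Q1 = - (P1 * neg_outer Q1).
  have /mulIf : (- 'X : {poly {poly k}}) ^+ j * 'X^j != 0.
    by rewrite mulf_neq0 ?expf_neq0 ?oppr_eq0 ?polyX_eq0.
  apply; move: outerPQ; rewrite PE QE ij !rmorphM !rmorphXn /= !comp_polyX mulrACA => ->.
  by rewrite mulNr mulrACA [X in - (_ * X) = _]mulrC.
move/(congr1 (fun p : {poly {poly k}} => p`_0))/eqP.
rewrite coefN !coef0M !neg_outer0 -addr_eq0 -mulr2n -mulr_natr mulf_eq0.
rewrite mulf_eq0 (negPf P10) (negPf Q10) /= -polyC_natr polyC_eq0.
by have /pcharf0P -> := char0.
Qed.

Lemma no_generic_odd_inverse (P Q D : {poly {poly k}}) : D != 0 ->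
  (forall s t, eval2 s t D != 0 -> eval2 s t Q != 0) ->
  (forall s t, eval2 s t D != 0 -> eval2 (- s) t D != 0 -> eval2 s (- t) D != 0 ->
     eval2 s t P * eval2 (- s) t P = eval2 s t Q * eval2 (- s) t Q /\
     eval2 s (- t) P * eval2 s t Q = - (eval2 s t P * eval2 s (- t) Q)) -> False.
Proof.
move=> D0 DQ PQ.
have Q0 : Q != 0.
  have [s [t Dst]] := eval2_neq0 D0.
  by apply: contraNneq (DQ s t Dst) => ->; rewrite rmorph0.
(* Where [E] is nonzero, [D] is nonzero at (s,t), (-s,t) and (s,-t), so both relations hold
   there. *)
pose E := D * (neg_inner D * neg_outer D).
have E0 : E != 0.
  have [s [t Dst]] := eval2_neq0 D0.
  rewrite !mulf_neq0 //.
    by apply: contraNneq Dst => D1; rewrite -[s]opprK -eval2_neg_inner D1 rmorph0.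
  by apply: contraNneq Dst => D1; rewrite -[t]opprK -eval2_neg_outer D1 rmorph0.
(* Multiplication by [E] extends a generic identity to the whole plane, where values determine a
   polynomial. *)
have generic p : (forall s t, eval2 s t E != 0 -> eval2 s t p = 0) -> p = 0.
  move=> Ep; apply: (mulIf E0); rewrite mul0r; apply: eval2_eq0 => s t; rewrite rmorphM.
  by have [->|/Ep ->] := eqVneq (eval2 s t E) 0; rewrite ?mulr0 ?mul0r.
have PQE s t : eval2 s t E != 0 ->
    [/\ eval2 s t D != 0, eval2 (- s) t D != 0 & eval2 s (- t) D != 0].
  by rewrite !rmorphM eval2_neg_inner eval2_neg_outer !mulf_eq0 !negb_or => /and3P.
apply: (@no_odd_inverse P Q Q0); apply/eqP; rewrite -subr_eq0; apply/eqP/generic => s t.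
  move=> /PQE[D1 D2 D3].
  rewrite rmorphB !rmorphM !eval2_neg_inner.
  by have [-> _] := PQ s t D1 D2 D3; rewrite subrr.
move=> /PQE[D1 D2 D3]; rewrite opprK rmorphD !rmorphM !eval2_neg_outer.
by have [_ ->] := PQ s t D1 D2 D3; rewrite addNr.
Qed.

End OddFunctions.

(** * Sets definable in the language of rings *)

Section Definability.
Variable k : closedFieldType.

(** Terms and formulas are hidden behind their semantics, so that definability follows from closure
    properties without explicit syntax. *)
Definition polynomial_fun (f : seq k -> k) : Prop :=
  exists2 t : GRing.term k, GRing.rterm t & forall e, GRing.eval e t = f e.

Definition definable (P : seq k -> Prop) : Prop :=
  exists2 f : GRing.formula k, GRing.rformula f & forall e, GRing.holds e f <-> P e.

Lemma eq_polynomial_fun f g : f =1 g -> polynomial_fun f -> polynomial_fun g.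
Proof. by move=> fg [t rt tf]; exists t => // e; rewrite tf fg. Qed.

Lemma polynomial_cst a : polynomial_fun (fun=> a).
Proof. by exists (GRing.Const a). Qed.

Lemma polynomial_var i : polynomial_fun (fun e => e`_i).
Proof. by exists (GRing.Var k i). Qed.

Lemma polynomial_add f g :
  polynomial_fun f -> polynomial_fun g -> polynomial_fun (fun e => f e + g e).
Proof.
move=> [t rt tf] [u ru ug]; exists (GRing.Add t u) => [|e] /=; first by rewrite rt.
by rewrite tf ug.
Qed.

Lemma polynomial_mul f g :
  polynomial_fun f -> polynomial_fun g -> polynomial_fun (fun e => f e * g e).
Proof.
move=> [t rt tf] [u ru ug]; exists (GRing.Mul t u) => [|e] /=; first by rewrite rt.
by rewrite tf ug.
Qed.

Lemma polynomial_exp f n : polynomial_fun f -> polynomial_fun (fun e => f e ^+ n).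
Proof. by move=> [t rt tf]; exists (GRing.Exp t n) => // e /=; rewrite tf. Qed.

Lemma polynomial_sum (I : Type) (r : seq I) (f : I -> seq k -> k) :
  (forall i, polynomial_fun (f i)) -> polynomial_fun (fun e => \sum_(i <- r) f i e).
Proof.
move=> pf; elim: r => [|i r IHr].
  by apply: eq_polynomial_fun (polynomial_cst 0) => e; rewrite big_nil.
by apply: eq_polynomial_fun (polynomial_add (pf i) IHr) => e; rewrite big_cons.
Qed.

Lemma polynomial_prod (I : Type) (r : seq I) (f : I -> seq k -> k) :
  (forall i, polynomial_fun (f i)) -> polynomial_fun (fun e => \prod_(i <- r) f i e).
Proof.
move=> pf; elim: r => [|i r IHr].
  by apply: eq_polynomial_fun (polynomial_cst 1) => e; rewrite big_nil.
by apply: eq_polynomial_fun (polynomial_mul (pf i) IHr) => e; rewrite big_cons.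
Qed.

Lemma polynomial_meval (n : nat) (p : {mpoly k[n]}) (v : seq k -> 'I_n -> k) :
  (forall i, polynomial_fun (v^~ i)) -> polynomial_fun (fun e => p.@[v e]).
Proof.
move=> pv.
apply: (@eq_polynomial_fun (fun e => \sum_(m <- msupp p) p@_m * \prod_i v e i ^+ m i)).
  by move=> e; rewrite mevalE.
apply: polynomial_sum => m; apply: polynomial_mul (polynomial_cst _) _.
by apply: polynomial_prod => i; apply: polynomial_exp.
Qed.

Definition polynomial_mx (m n : nat) (A : seq k -> 'M[k]_(m, n)) : Prop :=
  forall i j, polynomial_fun (fun e => A e i j).

Lemma polynomial_mulmx (m n p : nat) (A : seq k -> 'M[k]_(m, n)) (B : seq k -> 'M[k]_(n, p)) :
  polynomial_mx A -> polynomial_mx B -> polynomial_mx (fun e => A e *m B e).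
Proof.
move=> pA pB i j; apply: (@eq_polynomial_fun (fun e => \sum_l A e i l * B e l j)).
  by move=> e; rewrite mxE.
by apply: polynomial_sum => l; apply: polynomial_mul.
Qed.

Lemma polynomial_coords (n : nat) (A B : seq k -> 'M[k]_n) :
  polynomial_mx A -> polynomial_mx B -> forall i, polynomial_fun (fun e => coords (A e, B e) i).
Proof.
move=> pA pB i; rewrite /coords; case: (split_ordP i) => j ->.
  case/mxvec_indexP: j => a b; apply: eq_polynomial_fun (pA a b) => e.
  by rewrite row_mxEl mxvecE.
case/mxvec_indexP: j => a b; apply: eq_polynomial_fun (pB a b) => e.
by rewrite row_mxEr mxvecE.
Qed.

Lemma definable_eq f g :
  polynomial_fun f -> polynomial_fun g -> definable (fun e => f e = g e).
Proof.
move=> [t rt tf] [u ru ug]; exists (GRing.Equal t u) => [|e] /=; first by rewrite rt.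
by rewrite tf ug.
Qed.

Lemma definable_not P : definable P -> definable (fun e => ~ P e).
Proof. by move=> [f rf fP]; exists (GRing.Not f) => // e /=; rewrite fP. Qed.

Lemma definable_and P Q : definable P -> definable Q -> definable (fun e => P e /\ Q e).
Proof.
move=> [f rf fP] [g rg gQ]; exists (GRing.And f g) => [|e] /=; first by rewrite rf.
by rewrite fP gQ.
Qed.

Lemma eq_definable P Q : (forall e, P e <-> Q e) -> definable P -> definable Q.
Proof. by move=> PQ [f rf fP]; exists f => // e; rewrite fP. Qed.

Lemma definable_and4 P Q R S : definable P -> definable Q -> definable R -> definable S ->
  definable (fun e => [/\ P e, Q e, R e & S e]).
Proof.
move=> dP dQ dR dS.
apply: eq_definable (definable_and dP (definable_and dQ (definable_and dR dS))) => e.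
by split=> [[? [? []]]|[]].
Qed.

Lemma definable_all (T : eqType) (s : seq T) (P : T -> seq k -> Prop) :
  (forall x, definable (P x)) -> definable (fun e => forall x, x \in s -> P x e).
Proof.
move=> dP; elim: s => [|x s IHs].
  by apply: (@eq_definable (fun=> true)) => //; exists (GRing.Bool true).
apply: eq_definable (definable_and (dP x) IHs) => e; split=> [[Px Ps] y|Ps].
  by rewrite inE => /predU1P[->|/Ps].
by split=> [|y ys]; apply: Ps; rewrite inE ?eqxx ?ys ?orbT.
Qed.

Lemma definable_forall (I : finType) (P : I -> seq k -> Prop) :
  (forall i, definable (P i)) -> definable (fun e => forall i, P i e).
Proof.
move=> dP; apply: eq_definable (definable_all (enum I) dP) => e.
by split=> Pe i; [apply: Pe; rewrite mem_enum|].
Qed.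

Lemma definable_mx_eq (m n : nat) (A B : seq k -> 'M[k]_(m, n)) :
  polynomial_mx A -> polynomial_mx B -> definable (fun e => A e = B e).
Proof.
move=> pA pB; apply: (@eq_definable (fun e => forall i j, A e i j = B e i j)) => [e|].
  by split=> [/matrixP|->].
by apply: definable_forall => i; apply: definable_forall => j; apply: definable_eq.
Qed.

(** A formula holds finitely many equations, so the possibly infinite [S] is first replaced by a
    finite list. *)
Lemma definable_closed (n : nat) (Z : set (matrix_pair k n)) (A B : seq k -> 'M[k]_n) :
  zariski_closed Z -> polynomial_mx A -> polynomial_mx B -> definable (fun e => Z (A e, B e)).
Proof.
move=> [S ->] pA pB; have [T ST] := finite_zero_locus S.
apply: (@eq_definable (fun e => forall p, p \in T -> p.@[coords (A e, B e)] = 0)) => [e|].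
  exact: iff_sym (ST _).
apply: definable_all => p; apply: definable_eq (polynomial_cst 0).
by apply: polynomial_meval => i; apply: polynomial_coords.
Qed.

Lemma definable_constructible (n : nat) (N : set (matrix_pair k n)) (A B : seq k -> 'M[k]_n) :
  constructible N -> polynomial_mx A -> polynomial_mx B -> definable (fun e => N (A e, B e)).
Proof.
move=> [r [L [lcL ->]]] pA pB.
apply: (@eq_definable (fun e => ~ forall i, ~ L i (A e, B e))) => [e|].
  split=> [/existsNP[i /contrapT Li]|[i _ Li] noL]; first by exists i.
  exact: (noL i).
apply/definable_not/definable_forall => i; apply: definable_not.
have [U [Z [oU cZ ->]]] := lcL i; apply: definable_and; last exact: definable_closed.
apply: (@eq_definable (fun e => ~ (~` U)%classic (A e, B e))) => [e|].
  by split=> [/contrapT|Ue nU].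
exact/definable_not/definable_closed.
Qed.

(** [Exists d] sets variable [d]; in an environment of length exactly [d] this appends the
    witness. *)
Lemma definable_exists (P : seq k -> Prop) (r d : nat) : definable P ->
  exists2 f : GRing.formula k, GRing.rformula f &
    forall e, size e = d -> GRing.holds e f <-> exists2 v, size v = r & P (e ++ v).
Proof.
move=> [f rf fP]; elim: r d => [|r IHr] d.
  exists f => // e _; rewrite fP; split=> [Pe|[v /size0nil ->]]; last by rewrite cats0.
  by exists [::]; rewrite ?cats0.
have [g rg gP] := IHr d.+1; exists (GRing.Exists d g) => // e se /=.
have set_nthE x : set_nth 0 e d x = rcons e x by rewrite set_nthE se ltnn subnn cats1.
split=> [[x]|[[//|x v] /= [sv] Pxv]].
  rewrite set_nthE gP ?size_rcons ?se // => -[v sv Pv].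
  by exists (x :: v); rewrite /= ?sv // -cat_rcons.
by exists x; rewrite set_nthE gP ?size_rcons ?se //; exists v; rewrite ?cat_rcons.
Qed.

(** Variables 0, 1, 2 stand for s, t, m; later ones go to 0, their default value in an environment
    of three entries. *)
Fixpoint term_poly (t : GRing.term k) : {poly {poly {poly k}}} :=
  match t with
  | GRing.Var 0 => 'X%:P%:P
  | GRing.Var 1 => 'X%:P
  | GRing.Var 2 => 'X
  | GRing.Var _ => 0
  | GRing.Const a => a%:P%:P%:P
  | GRing.NatConst n => n%:R
  | GRing.Add t u => term_poly t + term_poly u
  | GRing.Opp t => - term_poly t
  | GRing.NatMul t n => term_poly t *+ n
  | GRing.Mul t u => term_poly t * term_poly u
  | GRing.Inv _ => 0
  | GRing.Exp t n => term_poly t ^+ n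
  end.

Lemma eval_term_poly s t m u :
  GRing.rterm u -> eval3 s t m (term_poly u) = GRing.eval [:: s; t; m] u.
Proof.
have evC a : eval3 s t m a%:P%:P%:P = a by rewrite eval3C eval2C hornerC.
have ev0 : eval3 s t m 'X%:P%:P = s by rewrite eval3C eval2C hornerX.
have ev1 : eval3 s t m 'X%:P = t by rewrite eval3C eval2X.
have ev2 : eval3 s t m 'X = m by rewrite eval3X.
move: (eval3 s t m) evC ev0 ev1 ev2 => ev evC ev0 ev1 ev2.
elim: u => //= [[|[|[|i]]] _|n _|u IHu v IHv /andP[/IHu <- /IHv <-]|u IHu /IHu <-|u IHu n /IHu <-
  |u IHu v IHv /andP[/IHu <- /IHv <-]|u IHu n /IHu <-] //.
- by rewrite rmorph0; case: i.
- by rewrite rmorph_nat.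
- by rewrite rmorphD.
- by rewrite rmorphN.
- by rewrite rmorphMn.
- by rewrite rmorphM.
- by rewrite rmorphXn.
Qed.

Fixpoint formula_polys (f : GRing.formula k) : seq {poly {poly {poly k}}} :=
  match f with
  | GRing.Equal t u => [:: term_poly t - term_poly u]
  | GRing.And f g | GRing.Or f g | GRing.Implies f g => formula_polys f ++ formula_polys g
  | GRing.Not f => formula_polys f
  | _ => [::]
  end.

Lemma agree_on_cat (fs gs : seq {poly {poly {poly k}}}) s t m s' t' m' :
  agree_on (fs ++ gs) s t m s' t' m' ->
  agree_on fs s t m s' t' m' /\ agree_on gs s t m s' t' m'.
Proof.
by move=> agree; split=> p pin; apply: agree; rewrite mem_cat pin ?orbT.
Qed.

Lemma qf_eval_agree f s t m s' t' m' : GRing.rformula f ->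
  agree_on (formula_polys f) s t m s' t' m' ->
  GRing.qf_eval [:: s; t; m] f = GRing.qf_eval [:: s'; t'; m'] f.
Proof.
elim: f => //= [u v /andP[ru rv] /(_ _ (mem_head _ _))||||].
- by rewrite !rmorphB !eval_term_poly // !subr_eq0.
- by move=> f IHf g IHg /andP[/IHf{}IHf /IHg{}IHg] /agree_on_cat[/IHf -> /IHg ->].
- by move=> f IHf g IHg /andP[/IHf{}IHf /IHg{}IHg] /agree_on_cat[/IHf -> /IHg ->].
- by move=> f IHf g IHg /andP[/IHf{}IHf /IHg{}IHg] /agree_on_cat[/IHf -> /IHg ->].
- by move=> f IHf /IHf{}IHf /IHf ->.
Qed.

(** A form of Chevalley's theorem: quantifier elimination over an algebraically closed field removes
    [w], and [fs] lists the atoms of the resulting formula. *)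
Lemma definable_projection (r : nat) (P : k -> k -> k -> 'rV[k]_r -> Prop) :
  definable (fun e => P e`_0 e`_1 e`_2 (\row_i e`_(i.+3))) ->
  exists fs : seq {poly {poly {poly k}}}, forall s t m s' t' m',
    agree_on fs s t m s' t' m' -> (exists w, P s t m w) -> exists w, P s' t' m' w.
Proof.
move=> /(definable_exists r 3)[f rf fP].
have wf_proj := @ClosedFieldQE.wf_ex_elim k.
have ok_proj := @ClosedFieldQE.holds_ex_elim k (@solve_monicpoly k).
pose q := GRing.quantifier_elim (@ClosedFieldQE.ex_elim k) f.
have /andP[_ rq] : GRing.qf_form q && GRing.rformula q.
  exact: GRing.quantifier_elim_wf.
have qP s t m : GRing.qf_eval [:: s; t; m] q <-> exists w, P s t m w.
  split=> [/(GRing.quantifier_elim_rformP wf_proj ok_proj _ rf)|[w Pw]].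
    by move=> /fP[//|v sv Pv]; eexists; exact: Pv.
  apply/(GRing.quantifier_elim_rformP wf_proj ok_proj _ rf)/fP => //.
  exists [seq w 0 i | i <- enum 'I_r]; first by rewrite size_map size_enum_ord.
  rewrite /= (_ : \row_i _ = w) //; apply/rowP => i.
  by rewrite mxE (nth_map i) ?size_enum_ord ?nth_ord_enum.
exists (formula_polys q) => s t m s' t' m' agree.
by rewrite -!qP (qf_eval_agree rq agree).
Qed.

End Definability.

(** * Normal forms of a quaternion family *)

Section QuaternionFamily.
Variables (k : closedFieldType) (n : nat) (i0 i1 : 'I_n).
Hypotheses (char0 : [pchar k] =i pred0) (i01 : i0 != i1).

Definition famA (s : k) : 'M[k]_n :=
  \matrix_(i, j) (s * ((i == i0)%:R * (j == i0)%:R - (i == i1)%:R * (j == i1)%:R)).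

Definition famB (t : k) : 'M[k]_n :=
  \matrix_(i, j) (t * ((i == i0)%:R * (j == i1)%:R + (i == i1)%:R * (j == i0)%:R)).

Lemma sum_eqr (F : 'I_n -> k) a : \sum_j (j == a)%:R * F j = F a.
Proof.
rewrite (bigD1 a) //= eqxx mul1r big1 ?addr0 // => j /negPf ->.
by rewrite mul0r.
Qed.

Lemma famA_mulmx s (w : 'M[k]_n) i j :
  (famA s *m w) i j = s * ((i == i0)%:R * w i0 j - (i == i1)%:R * w i1 j).
Proof.
rewrite mxE -!(sum_eqr (w^~ j)) !mulr_sumr -sumrB mulr_sumr.
by apply: eq_bigr => l _; rewrite mxE !mulrA -mulrBl !mulrA.
Qed.

Lemma famB_mulmx t (w : 'M[k]_n) i j :
  (famB t *m w) i j = t * ((i == i0)%:R * w i1 j + (i == i1)%:R * w i0 j).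
Proof.
rewrite mxE -!(sum_eqr (w^~ j)) !mulr_sumr -big_split /= mulr_sumr.
by apply: eq_bigr => l _; rewrite mxE !mulrA -mulrDl !mulrA.
Qed.

Lemma mulmx_famA s (w : 'M[k]_n) i j :
  (w *m famA s) i j = s * (w i i0 * (j == i0)%:R - w i i1 * (j == i1)%:R).
Proof.
rewrite mxE -!(sum_eqr (w i)) !mulr_suml -sumrB mulr_sumr.
apply: eq_bigr => l _; rewrite mxE mulrCA; congr (_ * _).
by rewrite mulrBr !mulrA ![_ * w i l]mulrC.
Qed.

Lemma mulmx_famB t (w : 'M[k]_n) i j :
  (w *m famB t) i j = t * (w i i0 * (j == i1)%:R + w i i1 * (j == i0)%:R).
Proof.
rewrite mxE -!(sum_eqr (w i)) !mulr_suml -big_split /= mulr_sumr.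
apply: eq_bigr => l _; rewrite mxE mulrCA; congr (_ * _).
by rewrite mulrDr !mulrA ![_ * w i l]mulrC.
Qed.

(** Columns [i0] and [i1] of [w] lie in the eigenspaces of [famA s] for [s] and [- s]. As 2 is
    nonzero, these values and 0 are distinct, so each column is a multiple of its basis vector;
    commuting with [famB t] equates the two factors. *)
Lemma commuting_fam s t (w : 'M[k]_n) : s != 0 -> t != 0 ->
  famA s *m w = w *m famA s -> famB t *m w = w *m famB t ->
  exists c, forall j, w j i0 = (j == i0)%:R * c /\ w j i1 = (j == i1)%:R * c.
Proof.
move=> s0 t0 /matrixP Aw /matrixP Bw; have i10 : (i1 == i0) = false by rewrite eq_sym (negPf i01).
have double0 (x : k) : x = - x -> x = 0.
  move/eqP; rewrite -addr_eq0 -mulr2n -mulr_natr mulf_eq0 => /orP[/eqP //|].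
  by have /pcharf0P -> := char0.
have w0 j : j != i0 -> w j i0 = 0.
  move=> /negPf j0; have := Aw j i0; rewrite famA_mulmx mulmx_famA => /(mulfI s0).
  rewrite j0 eqxx (negPf i01) mul0r sub0r mulr1 mulr0 subr0.
  have [->|_] := eqVneq j i1; first by rewrite mul1r => /esym/double0.
  by rewrite mul0r oppr0.
have w1 j : j != i1 -> w j i1 = 0.
  move=> /negPf j1; have := Aw j i1; rewrite famA_mulmx mulmx_famA => /(mulfI s0).
  rewrite j1 eqxx i10 mul0r subr0 mulr1 mulr0 sub0r.
  have [->|_] := eqVneq j i0; first by rewrite mul1r => /double0.
  by rewrite mul0r => /esym/eqP; rewrite oppr_eq0 => /eqP.
exists (w i0 i0) => j; split.
  by have [->|/w0] := eqVneq j i0; rewrite ?mul1r ?mul0r.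
have [->|/w1] := eqVneq j i1; rewrite ?mul1r ?mul0r //.
have := Bw i0 i1; rewrite famB_mulmx mulmx_famB => /(mulfI t0).
by rewrite !eqxx (negPf i01) i10 mul1r mul0r mulr1 mulr0 !addr0.
Qed.

Variable N : set (matrix_pair k n).
Hypothesis constructibleN : constructible N.
Hypothesis normalN : forall x,
  exists! y, (N `&` Defs.orbit (@simultaneous_conjugation k n) x)%classic y.

(** The inverse [h] is a variable of its own, which keeps the conjugates polynomial in the
    unknowns. *)
Definition normalizes (s t : k) (g h : 'M[k]_n) : Prop :=
  [/\ s != 0, t != 0, g *m h = 1%:M & N (g *m famA s *m h, g *m famB t *m h)].

Lemma normalizes_exists s t : s != 0 -> t != 0 -> exists g h, normalizes s t g h.
Proof.
move=> s0 t0; have [y [[Ny [[g gu] _ gy]] _]] := normalN (famA s, famB t).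
by exists g, (invmx g); split; rewrite ?mulmxV //; move: Ny; rewrite -gy.
Qed.

Lemma orbit_conjugation (x : matrix_pair k n) (g h : 'M[k]_n) : g *m h = 1%:M ->
  Defs.orbit (@simultaneous_conjugation k n) x (g *m x.1 *m h, g *m x.2 *m h).
Proof.
move=> gh; have [gu _] := mulmx1_unit gh.
have -> : h = invmx g by rewrite -[LHS](mulKmx gu) gh mulmx1.
by exists (exist _ g gu).
Qed.

(** Both conjugates are the one point of [N] in the orbit, so [h' *m g] commutes with the pair; the
    claim is read off [g = g' *m (h' *m g)]. *)
Lemma normalizes_uniq s t g h g' h' : normalizes s t g h -> normalizes s t g' h' ->
  exists c, forall i, g i i0 = c * g' i i0 /\ g i i1 = c * g' i i1.
Proof.
move=> [s0 t0 gh Ngh] [_ _ gh' Ngh'].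
have [y [_ uniq_y]] := normalN (famA s, famB t).
have : (g *m famA s *m h, g *m famB t *m h) = (g' *m famA s *m h', g' *m famB t *m h').
  by rewrite -[LHS]uniq_y -?[RHS]uniq_y //; split=> //;
     [apply: (orbit_conjugation (_, _) gh') | apply: (orbit_conjugation (_, _) gh)].
move=> [EA EB]; have hg := mulmx1C gh; have hg' := mulmx1C gh'.
have comm X : g *m X *m h = g' *m X *m h' -> X *m (h' *m g) = (h' *m g) *m X.
  move=> E; transitivity (h' *m (g' *m X *m h') *m g); first by rewrite !mulmxA hg' mul1mx.
  by rewrite -E -!mulmxA hg mulmx1.
have [c cP] := commuting_fam s0 t0 (comm _ EA) (comm _ EB).
exists c => i; have gE j : g i j = \sum_l g' i l * (h' *m g) l j.
  by rewrite -[g in LHS]mul1mx -gh' -mulmxA mxE.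
rewrite !gE -!(sum_eqr (g' i)) !mulr_sumr; split; apply: eq_bigr => l _.
  by have [-> _] := cP l; rewrite mulrCA [RHS]mulrCA [c * _]mulrC.
by have [_ ->] := cP l; rewrite mulrCA [RHS]mulrCA [c * _]mulrC.
Qed.

(** The involution [u] conjugates the pair for [(s', t')] into that for [(s, t)], so [g *m u] leads
    to the same point of [N]. *)
Lemma normalizes_transport s t s' t' (u g h : 'M[k]_n) :
  s' != 0 -> t' != 0 -> u *m u = 1%:M ->
  u *m famA s' = famA s *m u -> u *m famB t' = famB t *m u ->
  normalizes s t g h -> normalizes s' t' (g *m u) (u *m h).
Proof.
move=> s'0 t'0 uu uA uB [_ _ gh Ngh]; split=> //.
  by rewrite mulmxA -(mulmxA g) uu mulmx1.
rewrite -!(mulmxA g) uA uB -(mulmxA _ u) !mulmxA.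
by rewrite -2!(mulmxA (g *m _) u) uu !mulmx1.
Qed.

Lemma tperm_eq i : (tperm i0 i1 i == i0) = (i == i1) /\ (tperm i0 i1 i == i1) = (i == i0).
Proof.
by split; rewrite (can2_eq (tpermK i0 i1) (tpermK i0 i1)) ?tpermL ?tpermR.
Qed.

Lemma normalizes_swap s t g h : normalizes s t g h ->
  exists g' h', normalizes (- s) t g' h' /\ forall i, g' i i0 = g i i1 /\ g' i i1 = g i i0.
Proof.
move=> ngh; have [s0 t0 _ _] := ngh.
exists (g *m tperm_mx i0 i1), (tperm_mx i0 i1 *m h); split; last first.
  by move=> i; rewrite -xcolE !mxE tpermL tpermR.
apply: normalizes_transport ngh; rewrite ?oppr_eq0 //.
- by rewrite /tperm_mx -perm_mxM tperm2 perm_mx1.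
- rewrite -xrowE -xcolE; apply/matrixP => i j; rewrite !mxE.
  have [-> ->] := tperm_eq i; have [-> ->] := tperm_eq j.
  by rewrite mulNr -mulrN opprB.
rewrite -xrowE -xcolE; apply/matrixP => i j; rewrite !mxE.
have [-> ->] := tperm_eq i; have [-> ->] := tperm_eq j.
by rewrite addrC.
Qed.

(** Conjugation by the diagonal sign matrix fixes [famA] and negates [famB]. *)
Lemma normalizes_sign s t g h : normalizes s t g h ->
  exists g' h', normalizes s (- t) g' h' /\ forall i, g' i i0 = g i i0 /\ g' i i1 = - g i i1.
Proof.
move=> ngh; have [s0 t0 _ _] := ngh; have i10 : (i1 == i0) = false by rewrite eq_sym (negPf i01).
pose d : 'rV[k]_n := \row_j (if j == i1 then -1 else 1).
exists (g *m diag_mx d), (diag_mx d *m h); split; last first.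
  by move=> i; rewrite mul_mx_diag !mxE eqxx (negPf i01) mulr1 mulrN1.
apply: normalizes_transport ngh; rewrite ?oppr_eq0 //.
- rewrite mulmx_diag -diag_const_mx; congr diag_mx; apply/rowP => j; rewrite !mxE.
  by case: ifP; rewrite ?mulrNN mulr1.
- rewrite mul_mx_diag mul_diag_mx; apply/matrixP => i j; rewrite !mxE.
  by have [->|] := eqVneq i i1; have [->|] := eqVneq j i1; rewrite ?i10 
    ?(mul0r, mulr0, mul1r, mulr1, subr0, sub0r, mulN1r, mulrN1, oppr0, add0r, addr0).
rewrite mul_mx_diag mul_diag_mx; apply/matrixP => i j; rewrite !mxE.
by have [->|] := eqVneq i i1; have [->|] := eqVneq j i1; rewrite ?i10 
    ?(mul0r, mulr0, mul1r, mulr1, subr0, sub0r, mulN1r, mulrN1, oppr0, add0r, addr0) ?mulNr ?opprK.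
Qed.

(** [g] and [h] are packed into one row vector, the shape that [definable_projection] eliminates;
    the quotient is written without division to stay polynomial. *)
Definition slope (i : 'I_n) (s t m : k) : Prop :=
  exists w : 'rV[k]_(n * n + n * n), let g := vec_mx (lsubmx w) in
    normalizes s t g (vec_mx (rsubmx w)) /\ (g i i1 = m * g i i0 /\ g i i0 != 0).

Lemma slopeP i s t m : slope i s t m <->
  exists g h, normalizes s t g h /\ (g i i1 = m * g i i0 /\ g i i0 != 0).
Proof.
split=> [[w]|[g [h gh]]]; first by exists (vec_mx (lsubmx w)), (vec_mx (rsubmx w)).
by exists (row_mx (mxvec g) (mxvec h)); rewrite /= row_mxKl row_mxKr !mxvecK.
Qed.

Lemma slope_uniq i s t m m' : slope i s t m -> slope i s t m' -> m = m'.
Proof.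
move=> /slopeP[g [h [gh [gm g0]]]] /slopeP[g' [h' [gh' [gm' _]]]].
have [c /(_ i)[E0 E1]] := normalizes_uniq gh gh'.
by apply: (mulIf g0); rewrite -gm E1 gm' E0 mulrCA.
Qed.

(** Up to a common scalar, columns [i0] and [i1] of the normalizer for [(- s, t)] are those of [g]
    exchanged, which inverts the ratio. *)
Lemma slope_swap i s t m m' : slope i s t m -> slope i (- s) t m' -> m * m' = 1.
Proof.
move=> /slopeP[g [h [gh [gm g0]]]] /slopeP[g' [h' [gh' [gm' g'0]]]].
have [g2 [h2 [gh2 /(_ i)[g20 g21]]]] := normalizes_swap gh.
have [c /(_ i)[E0 E1]] := normalizes_uniq gh' gh2.
have c0 : c != 0 by apply: contraNneq g'0 => c0; rewrite E0 c0 mul0r.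
apply: (mulIf g0); apply: (mulfI c0); rewrite mul1r -g21 -E1 gm' E0 g20 gm g21.
by rewrite [RHS]mulrCA [m' * (m * _)]mulrA [m' * m]mulrC.
Qed.

Lemma slope_sign i s t m m' : slope i s t m -> slope i s (- t) m' -> m' = - m.
Proof.
move=> /slopeP[g [h [gh [gm g0]]]] /slopeP[g' [h' [gh' [gm' g'0]]]].
have [g2 [h2 [gh2 /(_ i)[g20 g21]]]] := normalizes_sign gh.
have [c /(_ i)[E0 E1]] := normalizes_uniq gh' gh2.
by apply: (mulIf g'0); rewrite -gm' E1 g21 E0 g20 gm mulNr mulrCA mulrN.
Qed.

(** An invertible matrix has no zero column; the row [i] found here may depend on [s] and [t]. *)
Lemma slope_exists s t : s != 0 -> t != 0 -> exists i m, slope i s t m.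
Proof.
move=> s0 t0; have [g [h gh]] := normalizes_exists s0 t0; have [_ _ g1 _] := gh.
have [i gi] : exists i, g i i0 != 0.
  apply/existsP; apply: contraT => /existsPn g0.
  have /matrixP/(_ i0 i0) := mulmx1C g1; rewrite !mxE eqxx big1 => [/esym/eqP|j _].
    by rewrite oner_eq0.
  by rewrite (eqP (negPn (g0 j))) mulr0.
by exists i, (g i i1 / g i i0); apply/slopeP; exists g, h; rewrite divfK.
Qed.

Lemma slope_definable i : exists fs : seq {poly {poly {poly k}}},
  forall s t m s' t' m', agree_on fs s t m s' t' m' -> slope i s t m -> slope i s' t' m'.
Proof.
apply: definable_projection.
have pg : polynomial_mx (fun e : seq k => vec_mx (lsubmx (\row_(l < n * n + n * n) e`_(l.+3)))).
  move=> a b; pose l := lshift (n * n) (mxvec_index a b).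
  by apply: eq_polynomial_fun (polynomial_var k l.+3) => e; rewrite !mxE.
have ph : polynomial_mx (fun e : seq k => vec_mx (rsubmx (\row_(l < n * n + n * n) e`_(l.+3)))).
  move=> a b; pose l := rshift (n * n) (mxvec_index a b).
  by apply: eq_polynomial_fun (polynomial_var k l.+3) => e; rewrite !mxE.
have pA : polynomial_mx (fun e => famA e`_0).
  move=> a b; apply: eq_polynomial_fun (polynomial_mul (polynomial_var _ 0) (polynomial_cst _)) => e.
  by rewrite mxE.
have pB : polynomial_mx (fun e => famB e`_1).
  move=> a b; apply: eq_polynomial_fun (polynomial_mul (polynomial_var _ 1) (polynomial_cst _)) => e.
  by rewrite mxE.
have neq0 f : polynomial_fun f -> definable (fun e => f e != 0).
  move=> pf; apply: eq_definable (definable_not (definable_eq pf (polynomial_cst 0))) => e.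
  by split=> /eqP.
apply: definable_and.
  apply: definable_and4.
  - exact/neq0/polynomial_var.
  - exact/neq0/polynomial_var.
  - apply: definable_mx_eq; first exact: polynomial_mulmx.
    by move=> a b; apply: polynomial_cst.
  - by apply: definable_constructible => //; do 2?apply: polynomial_mulmx.
apply: definable_and; last exact: neq0.
by apply: definable_eq => //; apply: polynomial_mul => //; apply: polynomial_var.
Qed.

Lemma no_normal_forms : False.
Proof.
(* There are finitely many rows, so one of them serves a dense set of parameters. *)
have [i dense_i] : exists i, dense (fun s t => exists m, slope i s t m).
  apply: dense_exists => D D0.
  (* The extra factor $st$ keeps the chosen point off the axes. *)
  have [|s [t]] := @eval2_neq0 k (D * ('X * 'X%:P)).
    by rewrite !mulf_neq0 ?polyC_eq0 ?polyX_eq0.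
  rewrite !rmorphM eval2C eval2X hornerX !mulf_eq0 !negb_or => /and3P[Dst t0 s0].
  by exists s, t; split=> //; apply: slope_exists.
have [fs fsP] := slope_definable i.
have [P [Q [D [D0 PQ]]]] := generic_rationality char0 fsP (@slope_uniq i) dense_i.
apply: (@no_generic_odd_inverse k char0 P Q D D0) => [s t /PQ[] //|s t].
move=> /PQ[Q1 S1] /PQ[Q2 S2] /PQ[Q3 S3]; split.
  have := slope_swap S1 S2; rewrite mulf_div => /(canRL (divfK _)).
  by rewrite mul1r; apply; rewrite mulf_neq0.
have /eqP := slope_sign S1 S3; rewrite -mulNr eqr_div // => /eqP ->.
by rewrite mulNr.
Qed.

End QuaternionFamily.

Close Scope ring_scope.

Theorem theorem3 (k : closedFieldType) (n : nat)
    (char0 : [pchar k]%R =i pred0) (n_ge2 : 2 <= n) :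
  ~ admits_normal_forms (@simultaneous_conjugation k n).
Proof.
move=> [N [constructibleN normalN]].
exact: (@no_normal_forms k n (Ordinal (ltnW n_ge2)) (Ordinal n_ge2) char0 isT N).
Qed.
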